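(* Let $M_8$ be the $8$-dimensional simple ternary Malcev algebra over $\mathbb{C}$ constructed from the $8$-dimensional composition algebra $A$, with its basis $e_1,\dots,e_8$ (as described in the context). A linear map $\nabla:M_8\to M_8$ is a local derivation of $M_8$ if and only if its matrix in the basis $e_1,\dots,e_8$ is antisymmetric. In particular, the space $LocDer\, M_8$ of all local derivations of $M_8$ has dimension $28$.
   Context: The base field is $\mathbb{C}$. Let $A$ be an $8$-dimensional composition algebra with unity $1$ and involution $a\mapsto\bar a$, such that the symmetric bilinear form $\langle x,y\rangle=\frac12(x\bar y+y\bar x)$ (which takes values in $\mathbb{C}\cdot 1\cong\mathbb{C}$) is nonsingular; the associated quadratic form $x\mapsto\langle x,x\rangle$ is multiplicative. $M_8$ is the vector space $A$ with the ternary multiplication $$[x,y,z]=(x\bar y)z-\langle y,z\rangle x+\langle x,z\rangle y-\langle x,y\rangle z.$$ Choose $a,b,c\in A$ such that $1,a,b,c$ are orthonormal for $\langle\cdot,\cdot\rangle$ and $c$ is also orthogonal to $ab$. The basis of $M_8$ is $e_1=1,\ e_2=a,\ e_3=b,\ e_4=ab,\ e_5=c,\ e_6=ac,\ e_7=bc,\ e_8=(ab)c$, where products are taken in $A$; it is orthonormal for $\langle\cdot,\cdot\rangle$. A derivation of $M_8$ is a linear map $D:M_8\to M_8$ with $D([x,y,z])=[D(x),y,z]+[x,D(y),z]+[x,y,D(z)]$ for all $x,y,z$. A local derivation of $M_8$ is a linear map $\nabla:M_8\to M_8$ such that for every $x\in M_8$ there exists a derivation $D_x$ of $M_8$ with $\nabla(x)=D_x(x)$.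 A matrix $B$ is antisymmetric if $B^T=-B$. *)

(* Defs.v *)
From HB Require Import structures.
From mathcomp Require Import all_boot all_order all_algebra.
From mathcomp Require Import complex.
From mathcomp Require Import reals.

Set Implicit Arguments.
Unset Strict Implicit.
Unset Printing Implicit Defensive.

Import GRing.Theory.

Local Open Scope ring_scope.

(* A unital, not necessarily associative algebra with involution.  The field
   [aformE] determines [aform] uniquely as soon as [aone != 0]; it also says that
   x ybar + y xbar is always a scalar multiple of the unity. *)
Record composition_algebra (F : fieldType) (A : vectType F) :=
  CompositionAlgebra {
  amul : {bilinear A -> A -> A};
  aone : A;
  aconj : {linear A -> A};
  aform : A -> A -> F;
  amul1x : forall x, amul aone x = x;
  amulx1 : forall x, amul x aone = x;
  aconjK : forall x, aconj (aconj x) = x;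
  aconjM : forall x y, aconj (amul x y) = amul (aconj y) (aconj x);
  aformE : forall x y,
    aform x y *: aone = 2^-1 *: (amul x (aconj y) + amul y (aconj x));
  aform_nonsingular : forall x, (forall y, aform x y = 0) -> x = 0;
  aform_multiplicative : forall x y,
    aform (amul x y) (amul x y) = aform x x * aform y y
}.

Section TernaryMalcev.
Variables (F : fieldType) (A : vectType F) (S : composition_algebra A).

Local Notation "x ** y" := (amul S x y) (at level 40, left associativity).
Local Notation "<| x , y |>" := (aform S x y).

Definition tmul (x y z : A) : A :=
  (x ** aconj S y) ** z - <|y, z|> *: x + <|x, z|> *: y - <|x, y|> *: z.

Definition is_derivation (D : 'End(A)) : Prop :=
  forall x y z : A,
    D (tmul x y z) = tmul (D x) y z + tmul x (D y) z + tmul x y (D z).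

Definition is_local_derivation (f : 'End(A)) : Prop :=
  forall x : A, exists D : 'End(A), is_derivation D /\ f x = D x.

Definition is_orthonormal (s : seq A) : Prop :=
  forall i j, (i < size s)%N -> (j < size s)%N ->
    <|s`_i, s`_j|> = (i == j)%:R.

Definition std_basis (a b c : A) : 8.-tuple A :=
  [tuple aone S; a; b; a ** b; c; a ** c; b ** c; (a ** b) ** c].

End TernaryMalcev.

(* Column j holds the coordinates of f e_j.  [coord e] gives coordinates in e
   only when e is free. *)
Definition mx_in_basis (F : fieldType) (A : vectType F) (n : nat)
    (e : n.-tuple A) (f : 'End(A)) : 'M[F]_n :=
  \matrix_(i, j) coord e i (f e`_j).

Definition antisymmetric_mx (F : fieldType) (n : nat) (B : 'M[F]_n) : Prop :=
  B^T = - B.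

(* Main.v *)
From HB Require Import structures.
Require Import Defs.
From mathcomp Require Import all_boot all_order all_algebra.
From mathcomp Require Import complex.
From mathcomp Require Import reals.
From mathcomp Require Import ring.

Set Implicit Arguments.
Unset Strict Implicit.
Unset Printing Implicit Defensive.

Import GRing.Theory Num.Theory.

Local Open Scope ring_scope.

(** A local derivation agrees at each vector with some derivation, so the
    theorem says two things: every derivation is skew for the form, and at each
    vector x the derivations already reach every value that a skew map can
    take, that is, every w orthogonal to x.  Geometrically, Der M_8 is the Lie
    algebra so(7) acting by its spin representation, and Spin(7) has the same
    orbits of nonzero vectors as SO(8).

    Derivations are skew ([derivation_skew]).  Iterating the product gives
    [x, y, [x, y, z]] = - (|x|^2 |y|^2 - <x,y>^2) z + (multiples of x and y)
    ([cross_cross]), so the product determines the form.  Applying a derivation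
    D, the terms in which D acts on vectors cancel, and there remains the same
    expression with each coefficient differentiated through the symmetric form
    B(u, v) = <Du,v> + <u,Dv>.  Read off at an orthonormal triple
    ([derivation_skew_triple]), this forces B to vanish on an orthonormal basis.

    Derivations reach every w orthogonal to x ([tangent_derivation]).  They are
    produced by projecting the elementary rotation
    x |-> <x,p> w - <x,w> p of so(8) on so(7), which up to a factor is
    [spin p w] : x |-> 3 (<x,p> w - <x,w> p) + [p, w, x].
    For p = 1 and u orthogonal to 1 it is L_u + 2 R_u, a derivation of
    (x ybar) z by the alternative laws alone ([spin1_derivation]).  Since a skew
    derivation commutes with the construction of [spin], the commutator of
    spin 1 p and spin 1 w is 3 (spin p w) modulo maps of the form spin 1 v, so
    that all of them are derivations ([spin_derivation]).  If x is not
    isotropic, spin x w maps x to 3 |x|^2 w.  If x is isotropic, choose p with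
    <x,p> = 1; then J = [p, ., x] satisfies J^2 w = w - <p,w> x on the
    orthogonal of x, and spin p w, spin p (J w) and spin p x map x to 3 w + J w,
    3 J w + J^2 w and 3 x, from which w = (9 w - J^2 w - <p,w> x) / 8 is
    recovered.

    It remains to see that the given basis is orthonormal, by two
    Cayley-Dickson doublings ([orthonormal_double]), so that skew maps are those
    with antisymmetric matrix, and to count dimensions. *)

(** Reduces a scalar consequence of an equation [a = b] to an identity for
    [ring]; all linear combinations of hypotheses below go through it. *)
Lemma eq_from_sub (V : zmodType) (a b c d : V) :
  a = b -> c - d = a - b -> c = d.
Proof. by move=> -> /eqP; rewrite subrr subr_eq0 => /eqP. Qed.

(** * Composition algebras *)

Section CompositionAlgebra.
Variables (F : numFieldType) (A : vectType F) (S : composition_algebra A).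
Hypothesis one_neq0 : aone S != 0.

Local Notation "x ** y" := (amul S x y) (at level 40, left associativity).
Local Notation "<| x , y |>" := (aform S x y).
Local Notation cj := (aconj S).
Local Notation one := (aone S).

Implicit Types (x y z t u v w p : A) (k : F).

Lemma amulDl x y z : (x + y) ** z = x ** z + y ** z.
Proof. exact: linearDl. Qed.
Lemma amulDr x y z : z ** (x + y) = z ** x + z ** y.
Proof. exact: linearDr. Qed.
Lemma amulNl x z : (- x) ** z = - (x ** z).
Proof. exact: linearNl. Qed.
Lemma amulNr x z : z ** (- x) = - (z ** x).
Proof. exact: linearNr. Qed.
Lemma amulZl k x z : (k *: x) ** z = k *: (x ** z).
Proof. by rewrite linearZl_LR. Qed.
Lemma amulZr k x z : z ** (k *: x) = k *: (z ** x).
Proof. by rewrite linearZr_LR. Qed.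

Lemma aconjD x y : cj (x + y) = cj x + cj y.
Proof. exact: linearD. Qed.
Lemma aconjN x : cj (- x) = - cj x.
Proof. exact: linearN. Qed.
Lemma aconjZ k x : cj (k *: x) = k *: cj x.
Proof. by rewrite linearZ. Qed.

Let amulE := (amulDl, amulDr, amulNl, amulNr, amulZl, amulZr).

Let scale_one_inj k k' : k *: one = k' *: one -> k = k'.
Proof.
move/eqP; rewrite -subr_eq0 -scalerBl scaler_eq0 (negPf one_neq0) orbF.
by rewrite subr_eq0 => /eqP.
Qed.

Lemma aformC x y : <|x, y|> = <|y, x|>.
Proof. by apply: scale_one_inj; rewrite !aformE addrC. Qed.

Lemma aformDl x y z : <|x + y, z|> = <|x, z|> + <|y, z|>.
Proof.
apply: scale_one_inj; rewrite scalerDl !aformE -scalerDr.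
by rewrite aconjD !amulE addrACA.
Qed.

Lemma aformZl k x z : <|k *: x, z|> = k * <|x, z|>.
Proof.
apply: scale_one_inj; rewrite -scalerA !aformE.
by rewrite aconjZ !amulE -scalerDr !scalerA mulrC.
Qed.

Lemma aformDr x y z : <|z, x + y|> = <|z, x|> + <|z, y|>.
Proof. by rewrite aformC aformDl !(aformC z). Qed.

Lemma aformZr k x z : <|z, k *: x|> = k * <|z, x|>.
Proof. by rewrite aformC aformZl (aformC z). Qed.

Lemma aformNl x z : <|- x, z|> = - <|x, z|>.
Proof. by rewrite -scaleN1r aformZl mulN1r. Qed.

Lemma aformNr x z : <|z, - x|> = - <|z, x|>.
Proof. by rewrite -scaleN1r aformZr mulN1r. Qed.

Lemma aform0l z : <|0, z|> = 0.
Proof. by rewrite -(scale0r 0) aformZl mul0r. Qed.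

Let aformEs := (aformDl, aformDr, aformNl, aformNr, aformZl, aformZr).

(** Vector identities are proved by pairing with an arbitrary [t]: the form
    turns them into scalar identities that [ring] decides. *)
Lemma aform_inj x y : (forall t, <|x, t|> = <|y, t|>) -> x = y.
Proof.
move=> eq_xy; apply/eqP; rewrite -subr_eq0; apply/eqP.
apply: (@aform_nonsingular _ _ S) => t.
by rewrite !aformEs eq_xy subrr.
Qed.

Lemma aconj1 : cj one = one.
Proof.
rewrite -[LHS](@amul1x _ _ S) -{1}(@aconjK _ _ S one) -aconjM.
by rewrite amul1x aconjK.
Qed.

Lemma aform11 : <|one, one|> = 1.
Proof.
apply: scale_one_inj; rewrite aformE aconj1 amul1x -mulr2n -scaler_nat.
by rewrite scalerA mulVf ?pnatr_eq0.
Qed.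

Lemma aconjE x : cj x = (2 * <|x, one|>) *: one - x.
Proof.
rewrite -scalerA aformE aconj1 amulx1 amul1x scalerA mulfV ?pnatr_eq0 //.
by rewrite scale1r addrC addKr.
Qed.

Lemma aform_conj x y : <|cj x, cj y|> = <|x, y|>.
Proof. by rewrite !aconjE !aformEs aform11 (aformC one); ring. Qed.

Lemma aformMl x y z : <|x ** y, x ** z|> = <|x, x|> * <|y, z|>.
Proof.
have := aform_multiplicative S x (y + z).
rewrite !amulE !aformEs !aform_multiplicative.
rewrite (aformC (x ** z)) (aformC z) => H.
apply: (mulfI (_ : 2 != 0)); first by rewrite pnatr_eq0.
by apply: (eq_from_sub H); ring.
Qed.

(** The polarization, in the left factor, of the composition law; all the
    identities of composition algebras below are extracted from it. *)
Lemma aformM_polar x y z w :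
  <|x ** y, w ** z|> + <|w ** y, x ** z|> = 2 * <|x, w|> * <|y, z|>.
Proof.
have := aformMl (x + w) y z; rewrite !amulE !aformEs !aformMl (aformC w) => H.
by apply: (eq_from_sub H); ring.
Qed.

(** The composition law polarized at the pair (x, 1). *)
Lemma aform_adjl x y z : <|x ** y, z|> = <|y, cj x ** z|>.
Proof.
have := aformM_polar x y z one; rewrite !amul1x => H.
rewrite aconjE !amulE amul1x !aformEs.
by apply: (eq_from_sub H); ring.
Qed.

Lemma aform_adjr x y z : <|y ** x, z|> = <|y, z ** cj x|>.
Proof.
by rewrite -aform_conj aconjM aform_adjl aconjK -aform_conj aconjM !aconjK.
Qed.

Lemma conj_mulKl x y : cj x ** (x ** y) = <|x, x|> *: y.
Proof.
by apply: aform_inj => t; rewrite aform_adjl aconjK aformMl aformZl.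
Qed.

Lemma mul_conjKr x y : (y ** cj x) ** x = <|x, x|> *: y.
Proof.
apply: (can_inj (@aconjK _ _ S)).
by rewrite !aconjM aconjK conj_mulKl aconjZ.
Qed.

Lemma mulK_conjr x y : (y ** x) ** cj x = <|x, x|> *: y.
Proof. by have := mul_conjKr (cj x) y; rewrite aconjK aform_conj. Qed.

Lemma mul_conj_polar x y : x ** cj y = (2 * <|x, y|>) *: one - y ** cj x.
Proof.
by rewrite -scalerA aformE scalerA mulfV ?pnatr_eq0 // scale1r addrK.
Qed.

Lemma mulC_polar x y :
  x ** y = (2 * <|x, one|>) *: y + (2 * <|y, one|>) *: x
           - (2 * <|x, y|>) *: one - y ** x.
Proof.
have := mul_conj_polar x y; rewrite !aconjE !amulE !amulx1 => H.
apply: aform_inj => t.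
have {}H := congr1 (aform S ^~ t) H; rewrite /= !aformEs in H.
by rewrite !aformEs; apply: (eq_from_sub (esym H)); ring.
Qed.

(** The linearized left alternative law, solved for u (x y): left
    multiplication by u is [L_u + R_u] on the first factor minus [L_u] on the
    second. *)
Lemma mul_alternl u x y :
  u ** (x ** y) = (u ** x + x ** u) ** y - x ** (u ** y).
Proof.
have H := conj_mulKl (u + x) y.
rewrite aconjD !amulE !conj_mulKl !aconjE !amulE !amul1x in H.
apply: aform_inj => t.
have {}H := congr1 (aform S ^~ t) H; rewrite /= !aformEs in H.
rewrite (mulC_polar u x) subrK !amulE !amul1x !aformEs.
by apply: (eq_from_sub (esym H)); rewrite (aformC x u); ring.
Qed.

Lemma mul_alternr u x y :
  (x ** y) ** u = x ** (u ** y + y ** u) - (x ** u) ** y.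
Proof.
apply: (can_inj (@aconjK _ _ S)).
by rewrite !(aconjM, aconjD, aconjN) mul_alternl (addrC (cj u ** _)).
Qed.

(** * The ternary product *)

(** The product [tmul], sealed: it is itself a sum, so that rewriting by
    additivity would otherwise match inside it. *)
Definition cross x y z : A := locked (tmul S x y z).

Local Notation "{[ x , y , z ]}" := (cross x y z).

Lemma crossE x y z :
  {[x, y, z]} =
    (x ** cj y) ** z - <|y, z|> *: x + <|x, z|> *: y - <|x, y|> *: z.
Proof. by rewrite /cross -lock. Qed.

Lemma crossDl x u y z : {[x + u, y, z]} = {[x, y, z]} + {[u, y, z]}.
Proof.
apply: aform_inj => t; rewrite !crossE !amulE !aformEs; ring.
Qed.
Lemma crossDm x u y z : {[y, x + u, z]} = {[y, x, z]} + {[y, u, z]}.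
Proof.
apply: aform_inj => t; rewrite !crossE !(aconjD, amulE) !aformEs; ring.
Qed.
Lemma crossDr x u y z : {[y, z, x + u]} = {[y, z, x]} + {[y, z, u]}.
Proof.
apply: aform_inj => t; rewrite !crossE !amulE !aformEs; ring.
Qed.
Lemma crossZl k x y z : {[k *: x, y, z]} = k *: {[x, y, z]}.
Proof.
apply: aform_inj => t; rewrite !crossE !amulE !aformEs; ring.
Qed.
Lemma crossZm k x y z : {[y, k *: x, z]} = k *: {[y, x, z]}.
Proof.
apply: aform_inj => t; rewrite !crossE !(aconjZ, amulE) !aformEs; ring.
Qed.
Lemma crossZr k x y z : {[y, z, k *: x]} = k *: {[y, z, x]}.
Proof.
apply: aform_inj => t; rewrite !crossE !amulE !aformEs; ring.
Qed.

Lemma crossNl x y z : {[- x, y, z]} = - {[x, y, z]}.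
Proof. by rewrite -scaleN1r crossZl scaleN1r. Qed.
Lemma crossNm x y z : {[y, - x, z]} = - {[y, x, z]}.
Proof. by rewrite -scaleN1r crossZm scaleN1r. Qed.
Lemma crossNr x y z : {[y, z, - x]} = - {[y, z, x]}.
Proof. by rewrite -scaleN1r crossZr scaleN1r. Qed.

Let cross_linear := (crossDl, crossDm, crossDr, crossZl, crossZm, crossZr,
              crossNl, crossNm, crossNr).

Lemma crossC12 x y z : {[x, y, z]} = - {[y, x, z]}.
Proof.
apply: aform_inj => t; rewrite (crossE x) (crossE y) (mul_conj_polar x).
by rewrite !amulE amul1x !aformEs (aformC y x); ring.
Qed.

Lemma crossC23 x y z : {[x, y, z]} = - {[x, z, y]}.
Proof.
have H := mul_conjKr (y + z) x; rewrite aconjD !amulE !mul_conjKr in H.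
apply: aform_inj => t.
have {}H := congr1 (aform S ^~ t) H; rewrite /= !aformEs in H.
rewrite !crossE !aformEs; apply: (eq_from_sub H); rewrite (aformC z y); ring.
Qed.

Lemma cross_rot x y z : {[x, y, z]} = {[z, x, y]}.
Proof. by rewrite crossC23 crossC12 opprK. Qed.

Lemma aform_cross_id x y z : <|{[x, y, z]}, z|> = 0.
Proof.
rewrite !crossE !aformEs aform_adjr aform_adjl.
have -> : z ** cj z = <|z, z|> *: one.
  by rewrite -[X in X ** _](@amul1x _ _ S) mulK_conjr.
rewrite amulZr aformZr amulx1 aform_conj.
rewrite (aformC y x); ring.
Qed.

(** On the orthogonal of x and y, [x, y, .] is multiplication by
    r = x ybar minus its scalar part <x,y>, and r satisfies its quadratic
    equation r^2 = 2 <x,y> r - |x|^2 |y|^2. *)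
Lemma cross_cross x y z :
  {[x, y, {[x, y, z]}]} =
    (<|y, y|> * <|x, z|> - <|x, y|> * <|y, z|>) *: x
  + (<|x, x|> * <|y, z|> - <|x, y|> * <|x, z|>) *: y
  - (<|x, x|> * <|y, y|> - <|x, y|> ^+ 2) *: z.
Proof.
set v := {[x, y, z]}; set r := x ** cj y.
have xv0 : <|x, v|> = 0 by rewrite aformC /v -cross_rot aform_cross_id.
have yv0 : <|y, v|> = 0 by rewrite aformC /v cross_rot aform_cross_id.
have rx : r ** x = (2 * <|x, y|>) *: x - <|x, x|> *: y.
  by rewrite /r mul_conj_polar !amulE amul1x mul_conjKr.
have ry : r ** y = <|y, y|> *: x by rewrite /r mul_conjKr.
have r1 : <|r, one|> = <|x, y|> by rewrite /r aform_adjr aconjK amul1x.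
have rr : <|r, r|> = <|x, x|> * <|y, y|>.
  by rewrite /r aform_multiplicative aform_conj.
have rrz : r ** (r ** z) =
    (2 * <|x, y|>) *: (r ** z) - (<|x, x|> * <|y, y|>) *: z.
  by rewrite -rr -conj_mulKl aconjE r1 !amulE amul1x opprB addrC subrK.
have vE : v = r ** z - <|y, z|> *: x + <|x, z|> *: y - <|x, y|> *: z.
  exact: crossE.
have -> : {[x, y, v]} = r ** v - <|x, y|> *: v.
  by rewrite [LHS]crossE xv0 yv0 !scale0r subr0 addr0.
apply: aform_inj => t; rewrite vE !amulE rrz rx ry !aformEs; ring.
Qed.

(** * Derivations *)

Definition skew_adjoint (f : 'End(A)) := forall x y, <|f x, y|> = - <|x, f y|>.

Lemma skew_adjoint_id (f : 'End(A)) :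
  (forall x, <|f x, x|> = 0) -> skew_adjoint f.
Proof.
move=> f0 x y; have := f0 (x + y).
rewrite linearD !aformEs !f0 add0r addr0 (aformC (f y)) => H.
by apply: (eq_from_sub H); ring.
Qed.

Lemma derivationP (D : 'End(A)) :
  is_derivation S D <->
  forall x y z, D {[x, y, z]} = {[D x, y, z]} + {[x, D y, z]} + {[x, y, D z]}.
Proof.
by split=> derD x y z; have := derD x y z; rewrite /cross -!lock.
Qed.

Lemma derivationD D E : is_derivation S D -> is_derivation S E ->
  is_derivation S (D + E).
Proof.
move=> /derivationP derD /derivationP derE; apply/derivationP => x y z.
rewrite !add_lfunE derD derE.
rewrite crossDl crossDm crossDr; apply: aform_inj => t; rewrite !aformEs; ring.
Qed.

Lemma derivationZ k D : is_derivation S D -> is_derivation S (k *: D).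
Proof.
move=> /derivationP derD; apply/derivationP => x y z.
by rewrite !scale_lfunE derD crossZl crossZm crossZr !scalerDr.
Qed.

Lemma derivation_comm D E : is_derivation S D -> is_derivation S E ->
  is_derivation S ((D \o E)%VF - (E \o D)%VF).
Proof.
move=> /derivationP derD /derivationP derE; apply/derivationP => x y z.
rewrite !(add_lfunE, opp_lfunE, comp_lfunE).
rewrite derD derE !linearD /= !derD !derE.
rewrite !cross_linear.
apply: aform_inj => t; rewrite !aformEs; ring.
Qed.

(** Four times the projection on so(7) of the elementary rotation E_pw in the
    plane of p and w: the map sending each E_pw to [p, w, .] has eigenvalue 1
    on so(7) and -3 on the complement of so(7) in so(8). *)
Definition spin p w : 'End(A) :=
  linfun (fun x => 3 *: (<|x, p|> *: w - <|x, w|> *: p) + {[p, w, x]}).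

Lemma spinE p w x :
  spin p w x = 3 *: (<|x, p|> *: w - <|x, w|> *: p) + {[p, w, x]}.
Proof.
pose f x := 3 *: (<|x, p|> *: w - <|x, w|> *: p) + {[p, w, x]}.
have lin_f : linear f.
  move=> k y z; rewrite /f crossDr crossZr.
  by apply: aform_inj => t; rewrite !aformEs; ring.
pose flM := GRing.isLinear.Build _ _ _ _ f lin_f.
pose fL : {linear A -> A} := HB.pack f flM.
exact: (lfunE fL).
Qed.

Lemma spin_skew p w : skew_adjoint (spin p w).
Proof.
apply: skew_adjoint_id => x; rewrite spinE aformDl aform_cross_id !aformEs.
rewrite (aformC x p) (aformC x w); ring.
Qed.

(** For u orthogonal to 1 this is L_u + 2 R_u; the last term makes it vanish
    at u = 1. *)
Lemma spin1E u x :
  spin one u x = u ** x + 2 *: (x ** u) - (3 * <|u, one|>) *: x.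
Proof.
rewrite spinE !crossE amul1x aconjE !amulE amul1x (mulC_polar x u).
apply: aform_inj => t; rewrite !aformEs (aformC u x) (aformC one u).
rewrite (aformC one x); ring.
Qed.

(** Skewness takes care of the terms of the product that involve the form, and
    leaves the derivation property for (x ybar) z, which follows from the
    linearized alternative laws. *)
Lemma spin1_derivation u : is_derivation S (spin one u).
Proof.
set E := spin one u.
have E_mul x y z : E ((x ** cj y) ** z) =
    (E x ** cj y) ** z + (x ** cj (E y)) ** z + (x ** cj y) ** E z.
  rewrite !spin1E !(aconjD, aconjN, aconjZ, aconjM) (aconjE u).
  rewrite (mul_alternl u (x ** cj y) z) (mul_alternr u (x ** cj y) z).
  rewrite !amulE (mul_alternl u x (cj y)) (mul_alternr u x (cj y)).
  rewrite !(amulE, amul1x, amulx1).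
  by apply: aform_inj => t; rewrite !aformEs; ring.
have skE := spin_skew one u; rewrite -/E in skE.
apply/derivationP => x y z; rewrite !crossE !linearD !linearN !linearZ /= E_mul.
by apply: aform_inj => t; rewrite !aformEs !skE; ring.
Qed.

(** [spin] is built from the form and the product, both preserved by E. *)
Lemma spin_equivariant E p w : is_derivation S E -> skew_adjoint E ->
  forall x, E (spin p w x) - spin p w (E x) = spin (E p) w x + spin p (E w) x.
Proof.
move=> /derivationP derE skE x.
rewrite !spinE !(linearD, linearN, linearZ) /= derE.
by apply: aform_inj => t; rewrite !aformEs !skE; ring.
Qed.

(** Equivariance for E = spin 1 p, with E 1 = 3 (p - <p,1> 1), gives
    [E, spin 1 w] = 3 spin p w - 3 <p,1> spin 1 w + spin 1 (E w). *)
Lemma spin_derivation p w : is_derivation S (spin p w).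
Proof.
suff -> : spin p w = 3^-1 *:
    (((spin one p \o spin one w)%VF - (spin one w \o spin one p)%VF)
     + (3 * <|p, one|>) *: spin one w + (-1) *: spin one (spin one p w)).
  apply: derivationZ; apply: derivationD; first apply: derivationD.
  - by apply: derivation_comm; apply: spin1_derivation.
  - by apply: derivationZ; apply: spin1_derivation.
  - by apply: derivationZ; apply: spin1_derivation.
apply/lfunP => x; rewrite scale_lfunE !add_lfunE !opp_lfunE !comp_lfunE.
rewrite (spin_equivariant one w (spin1_derivation p) (spin_skew one p)).
rewrite !scale_lfunE (spin1E p one) amul1x amulx1.
rewrite !spinE !cross_linear.
by apply: aform_inj => t; rewrite !aformEs; field.
Qed.

(** * Values of derivations at a vector *)

Lemma aform_sumr I (r : seq I) (P : pred I) (f : I -> A) x :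
  <|x, \sum_(i <- r | P i) f i|> = \sum_(i <- r | P i) <|x, f i|>.
Proof.
apply: (big_morph _ (id1 := 0)) => [y z|]; first exact: aformDr.
by rewrite aformC aform0l.
Qed.

Lemma aform_dual x : x != 0 -> exists p, <|x, p|> = 1.
Proof.
move=> x_neq0; pose b := vbasis {:A}.
have [i xbi|xb0] := pickP (fun i : 'I_(\dim {:A}) => <|x, b`_i|> != 0).
  by exists (<|x, b`_i|>^-1 *: b`_i); rewrite aformZr mulVf.
case/eqP: x_neq0; apply: (@aform_nonsingular _ _ S) => y.
rewrite (coord_vbasis (memvf y)) aform_sumr big1 // => i _.
by move/negbFE/eqP: (xb0 i) => xbi; rewrite aformZr xbi mulr0.
Qed.

(** The infinitesimal form of the fact that Spin(7) acts on nonzero vectors,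
    isotropic ones included, with the same orbits as SO(8). *)
Lemma tangent_derivation x w : x != 0 -> <|x, w|> = 0 ->
  exists D : 'End(A), is_derivation S D /\ w = D x.
Proof.
move=> x_neq0 xw; have cross0 u v : {[u, v, v]} = 0.
  by apply: aform_inj => t; rewrite crossE mul_conjKr !aformEs aform0l; ring.
(* x not isotropic: the choice p = x kills the bracket. *)
have [xx|xx_neq0] := eqVneq <|x, x|> 0; last first.
  exists ((3 * <|x, x|>)^-1 *: spin x w).
  split; first exact/derivationZ/spin_derivation.
  rewrite scale_lfunE spinE xw scale0r subr0 -(cross_rot w x x) cross0.
  by rewrite addr0 !scalerA mulVf ?scale1r ?mulf_neq0 ?pnatr_eq0.
(* x isotropic: J^2 w is w up to a multiple of x, so that w + J w / 3 and
   J w + J^2 w / 3 together determine w. *)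
have [p xp] := aform_dual x_neq0.
pose Jw := {[p, w, x]}.
have xJw : <|x, Jw|> = 0 by rewrite aformC aform_cross_id.
have JJw : {[p, Jw, x]} = w - <|p, w|> *: x.
  rewrite /Jw !(cross_rot p _ x) cross_cross xx xw xp.
  by apply: aform_inj => t; rewrite !aformEs; ring.
pose D : 'End(A) := 8^-1 *:
  (3 *: spin p w + (-1) *: spin p Jw + (- (<|p, w|> / 3)) *: spin p x).
exists D.
split.
  by apply: derivationZ; apply: derivationD; first apply: derivationD;
    apply: derivationZ; apply: spin_derivation.
rewrite /D !(scale_lfunE, add_lfunE) !spinE JJw cross0 xx xp xw xJw.
by rewrite -/Jw; apply: aform_inj => t; rewrite !aformEs aform0l; field.
Qed.

(** Differentiating [cross_cross] along D leaves an equation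
    between x, y and z whose coefficients are values of <Du,v> + <u,Dv>; the
    conclusions are its components along z and x. *)
Lemma derivation_skew_triple D x y z : is_derivation S D ->
  <|x, x|> = 1 -> <|y, y|> = 1 -> <|z, z|> = 1 ->
  <|x, y|> = 0 -> <|x, z|> = 0 -> <|y, z|> = 0 ->
  <|D x, x|> + <|D y, y|> = 0 /\ <|D x, z|> + <|x, D z|> = 0.
Proof.
move=> /derivationP derD xx yy zz xy xz yz.
(* [rhs] is quadratic in x and in y, so the derivative of the left side of
   [cross_cross] is given by its polarizations [px] and [py]. *)
pose rhs x y z :=
    (<|y, y|> * <|x, z|> - <|x, y|> * <|y, z|>) *: x
  + (<|x, x|> * <|y, z|> - <|x, y|> * <|x, z|>) *: y
  - (<|x, x|> * <|y, y|> - <|x, y|> ^+ 2) *: z.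
have ccE u v r : {[u, v, {[u, v, r]}]} = rhs u v r by apply: cross_cross.
have px u : {[u, y, {[x, y, z]}]} + {[x, y, {[u, y, z]}]}
    = rhs (x + u) y z - rhs x y z - rhs u y z.
  rewrite -!ccE !cross_linear.
  by apply: aform_inj => t; rewrite !aformEs; ring.
have py u : {[x, u, {[x, y, z]}]} + {[x, y, {[x, u, z]}]}
    = rhs x (y + u) z - rhs x y z - rhs x u z.
  rewrite -!ccE !cross_linear.
  by apply: aform_inj => t; rewrite !aformEs; ring.
have H : D (rhs x y z) =
    (rhs (x + D x) y z - rhs x y z - rhs (D x) y z)
  + (rhs x (y + D y) z - rhs x y z - rhs x (D y) z) + rhs x y (D z).
  rewrite -px -py -!ccE !derD !cross_linear.
  by apply: aform_inj => t; rewrite !aformEs; ring.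
have Hz := congr1 (aform S ^~ z) H; have Hx := congr1 (aform S ^~ x) H.
have yx : <|y, x|> = 0 by rewrite aformC.
have zx : <|z, x|> = 0 by rewrite aformC.
have zy : <|z, y|> = 0 by rewrite aformC.
have n2 : (2 : F) != 0 by rewrite pnatr_eq0.
rewrite /rhs !(linearD, linearN, linearZ) /= !aformEs in Hz Hx.
rewrite !(xx, yy, zz, xy, xz, yz, yx, zx, zy) in Hz Hx.
rewrite (aformC y (D y)) (aformC x (D x)) in Hz; rewrite (aformC x (D x)) in Hx.
split.
  apply: (mulfI n2); apply: (eq_from_sub Hz); ring.
apply: (eq_from_sub (esym Hx)); ring.
Qed.

(** * Orthonormal bases *)

Lemma aform_suml I (r : seq I) (P : pred I) (f : I -> A) x :
  <|\sum_(i <- r | P i) f i, x|> = \sum_(i <- r | P i) <|f i, x|>.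
Proof.
by rewrite aformC aform_sumr; apply: eq_bigr => i _; rewrite aformC.
Qed.

(** The Cayley-Dickson doubling step: right multiplication by a unit vector is
    an isometry. *)
Lemma orthonormal_double s u : is_orthonormal S s -> <|u, u|> = 1 ->
  {in s &, forall h h', <|h ** u, h'|> = 0} ->
  is_orthonormal S (s ++ [seq h ** u | h <- s]).
Proof.
move=> orth_s uu hu i j; rewrite size_cat size_map => lt_i lt_j.
have aformMr h h' : <|h ** u, h' ** u|> = <|h, h'|>.
  by rewrite aform_adjr mulK_conjr uu scale1r.
have lt_sub m : (m < size s + size s)%N -> (size s <= m)%N ->
    (m - size s < size s)%N by move=> lt_m le_m; rewrite ltn_subLR.
rewrite !nth_cat; case: ltnP => le_i; case: ltnP => le_j.
- exact: orth_s.
- rewrite aformC (nth_map 0) ?lt_sub // hu ?mem_nth ?lt_sub //.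
  by rewrite ltn_eqF // (leq_trans le_i).
- rewrite (nth_map 0) ?lt_sub // hu ?mem_nth ?lt_sub //.
  by rewrite gtn_eqF // (leq_trans le_j).
rewrite !(nth_map 0) ?lt_sub // aformMr orth_s ?lt_sub //.
by rewrite eqn_sub2rE.
Qed.

Lemma std_basis_orthonormal a b c :
  is_orthonormal S [:: one; a; b; c] -> <|c, a ** b|> = 0 ->
  is_orthonormal S (std_basis S a b c).
Proof.
move=> orth c_ab.
have bb : <|b, b|> = 1 := orth 2%N 2%N isT isT.
have cc : <|c, c|> = 1 := orth 3%N 3%N isT isT.
have a1 : <|a, one|> = 0 := orth 1%N 0%N isT isT.
have b1 : <|b, one|> = 0 := orth 2%N 0%N isT isT.
have c1 : <|c, one|> = 0 := orth 3%N 0%N isT isT.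
have ba : <|b, a|> = 0 := orth 2%N 1%N isT isT.
have ca : <|c, a|> = 0 := orth 3%N 1%N isT isT.
have cb : <|c, b|> = 0 := orth 3%N 2%N isT isT.
have hc h h' : <|h ** c, h'|> = - <|h' ** c, h|>.
  apply: (eq_from_sub (aformM_polar h c one h')).
  by rewrite !amulx1 c1; ring.
have hb h h' : <|h ** b, h'|> = - <|h' ** b, h|>.
  apply: (eq_from_sub (aformM_polar h b one h')).
  by rewrite !amulx1 b1; ring.
have skew0 (k : F) : k = - k -> k = 0.
  move=> kN; apply: (mulfI (_ : 2 != 0)); first by rewrite pnatr_eq0.
  by rewrite mulr0; apply: (eq_from_sub kN); ring.
have orth_ab : is_orthonormal S [:: one; a; b; a ** b].
  have -> : [:: one; a; b; a ** b] =
      [:: one; a] ++ [seq h ** b | h <- [:: one; a]].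
    by rewrite /= amul1x.
  apply: orthonormal_double => //.
    move=> i j lt_i lt_j.
      have := orth i j (ltn_trans lt_i _) (ltn_trans lt_j _).
    by case: i j lt_i lt_j => [|[|i]] [|[|j]] // _ _; apply.
  have h1a : <|one ** b, a|> = 0 by rewrite amul1x.
  move=> h h'; rewrite !inE => /orP[]/eqP-> /orP[]/eqP->.
  - exact/skew0/hb.
  - by [].
  - by rewrite hb h1a oppr0.
  - exact/skew0/hb.
have -> : std_basis S a b c = [:: one; a; b; a ** b]
    ++ [seq h ** c | h <- [:: one; a; b; a ** b]] :> seq A.
  by rewrite /= amul1x.
apply: orthonormal_double => //.
have h1a : <|one ** c, a|> = 0 by rewrite amul1x.
have h1b : <|one ** c, b|> = 0 by rewrite amul1x.
have h1ab : <|one ** c, a ** b|> = 0 by rewrite amul1x.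
have hab : <|a ** c, b|> = 0.
  by rewrite aform_adjl aconjE a1 mulr0 scale0r sub0r amulNl aformNr c_ab oppr0.
have haab : <|a ** c, a ** b|> = 0 by rewrite aformMl cb mulr0.
have hbab : <|b ** c, a ** b|> = 0.
  have bbN : b ** b = - one.
    have := mulK_conjr b one; rewrite bb scale1r amul1x aconjE b1.
    by rewrite mulr0 scale0r sub0r amulNr => <-; rewrite opprK.
  have ac1 : <|a ** c, one|> = 0.
    rewrite aform_adjr amul1x aconjE c1 mulr0 scale0r sub0r aformNr.
    by rewrite aformC ca oppr0.
  apply: (eq_from_sub (aformM_polar b c b a)).
  by rewrite ba bbN aformNr ac1; ring.
(* [hc] makes <h c, h'> antisymmetric in h and h', so that one order of each
   pair suffices. *)
have vanish h h' : <|h ** c, h'|> = 0 -> <|h' ** c, h|> = 0.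
  by move=> hh'; rewrite hc hh' oppr0.
move=> h h'; rewrite !inE.
by move=> /or4P[]/eqP-> /or4P[]/eqP->;
  (exact/skew0/hc || by [] || exact: vanish).
Qed.

Lemma orthonormal_free n (e : n.-tuple A) : is_orthonormal S e -> free e.
Proof.
move=> orth; apply/freeP => k sum0 i.
have := congr1 (aform S e`_i) sum0.
rewrite aform_sumr (bigD1 i) //= big1 => [|j ji].
  by rewrite aformZr orth ?size_tuple // eqxx mulr1 addr0 aformC aform0l.
rewrite aformZr orth ?size_tuple // eq_sym.
by rewrite (negPf (ji : val j != val i)) mulr0.
Qed.

Section OrthonormalBasis.
Variables (n : nat) (e : n.-tuple A).
Hypotheses (e_orth : is_orthonormal S e) (e_basis : basis_of {:A} e).

Lemma orthonormal_coord i x : coord e i x = <|e`_i, x|>.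
Proof.
rewrite {2}(coord_basis e_basis (memvf x)) aform_sumr (bigD1 i) //= big1.
  by rewrite aformZr e_orth ?size_tuple // eqxx mulr1 addr0.
move=> j ji; rewrite aformZr e_orth ?size_tuple //.
by rewrite eq_sym (negPf (ji : val j != val i)) mulr0.
Qed.

Lemma skew_adjoint_basis (f : 'End(A)) :
  (forall i j : 'I_n, <|f e`_i, e`_j|> = - <|e`_i, f e`_j|>) -> skew_adjoint f.
Proof.
move=> fe x y.
rewrite (coord_basis e_basis (memvf x)) (coord_basis e_basis (memvf y)).
rewrite !linear_sum !aform_suml -sumrN; apply: eq_bigr => i _.
rewrite !aform_sumr -sumrN; apply: eq_bigr => j _.
by rewrite !linearZ /= !aformEs fe; ring.
Qed.

Lemma antisymmetric_mxP (f : 'End(A)) :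
  antisymmetric_mx (mx_in_basis e f) <-> skew_adjoint f.
Proof.
split=> [/matrixP anti|skf].
  apply: skew_adjoint_basis => i j.
  by have := anti i j; rewrite !mxE !orthonormal_coord aformC.
apply/matrixP => i j; rewrite !mxE !orthonormal_coord.
by rewrite -skf aformC.
Qed.

Hypothesis n_gt2 : (2 < n)%N.

(** The condition on n provides, for each pair of basis vectors, a third one
    completing it to an orthonormal triple.  On the diagonal, <D e_i, e_i> and
    two other such values have vanishing pairwise sums, hence vanish. *)
Lemma derivation_skew D : is_derivation S D -> skew_adjoint D.
Proof.
move=> derD.
have third i j : exists2 k : 'I_n, k != i & k != j.
  have : ~~ ([set: 'I_n] \subset [set i; j]).
    apply: contraL n_gt2 => /subset_leq_card; rewrite cardsT card_ord -leqNgt.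
    by move=> /leq_trans; apply; rewrite cards2; case: eqP.
  by case/subsetPn => k _; rewrite !inE negb_or => /andP[]; exists k.
have nrm (i : 'I_n) : <|e`_i, e`_i|> = 1 by rewrite e_orth ?size_tuple ?eqxx.
have ort (i j : 'I_n) : i != j -> <|e`_i, e`_j|> = 0.
  by move=> ij; rewrite e_orth ?size_tuple // (negPf (ij : val i != val j)).
have triple (i k j : 'I_n) : i != k -> i != j -> k != j ->
    <|D e`_i, e`_i|> + <|D e`_k, e`_k|> = 0 /\
    <|D e`_i, e`_j|> + <|e`_i, D e`_j|> = 0.
  by move=> ik ij kj; apply: derivation_skew_triple; rewrite ?nrm ?ort.
apply: skew_adjoint_basis => i j; have [<-{j}|ij] := eqVneq i j.
  have [j ji _] := third i i; have [k ki kj] := third i j.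
  rewrite !(eq_sym _ i) in ji ki; rewrite eq_sym in kj.
  have [Bij _] := triple i j k ji ki kj.
  have [Bik _] := triple i k j ki ji (contra_neq esym kj).
  have [Bjk _] := triple j k i kj (contra_neq esym ji) (contra_neq esym ki).
  have Bii : <|D e`_i, e`_i|> = 0.
    apply: (mulfI (_ : 2 != 0)); first by rewrite pnatr_eq0.
    have E := etrans (congr2 +%R Bij Bik) (etrans (addr0 0) (esym Bjk)).
    by rewrite mulr0; apply: (eq_from_sub E); ring.
  by rewrite (aformC e`_i) Bii oppr0.
have [k ki kj] := third i j; rewrite eq_sym in ki.
have [_ /eqP] := triple i k j ki ij kj.
by rewrite addr_eq0 => /eqP.
Qed.

Theorem local_derivationP (f : 'End(A)) :
  is_local_derivation S f <-> skew_adjoint f.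
Proof.
split=> [locf|skf x].
  apply: skew_adjoint_id => x; have [D [/derivation_skew skD ->]] := locf x.
  apply: (mulfI (_ : 2 != 0)); first by rewrite pnatr_eq0.
  by rewrite mulr0; apply: (eq_from_sub (skD x x)); rewrite (aformC x); ring.
have [->|x_neq0] := eqVneq x 0.
  exists (0 *: f); split; last by rewrite !linear0.
  by apply/derivationP => u v w; rewrite !scale_lfunE !scale0r -(scale0r 0)
    !cross_linear !scale0r !addr0.
have [||D [derD fxD]] := @tangent_derivation x (f x) => //; last by exists D.
apply: (mulfI (_ : 2 != 0)); first by rewrite pnatr_eq0.
by rewrite mulr0; apply: (eq_from_sub (skf x x)); rewrite (aformC x); ring.
Qed.

End OrthonormalBasis.
End CompositionAlgebra.

(** * The space of maps with antisymmetric matrix *)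

Section SkewMatrices.
Variables (F : numFieldType) (A : vectType F).

Lemma antisymmetric_mx_tr n (B : 'M[F]_n) :
  antisymmetric_mx B^T <-> antisymmetric_mx B.
Proof.
rewrite /antisymmetric_mx trmxK; split=> [H|->]; last by rewrite opprK.
by rewrite {2}H opprK.
Qed.

(** The row space of [skew_def], which consists of the antisymmetric matrices,
    is transported to endomorphisms through the basis, up to a transpose since
    [hommx] acts on row vectors. *)
Lemma antisymmetric_space n (e : n.-tuple A) : basis_of {:A} e ->
  exists V : {vspace 'End(A)},
    (forall f, f \in V <-> antisymmetric_mx (mx_in_basis e f)) /\
    \dim V = 'C(n, 2).
Proof.
move=> e_basis; have n_dim := size_basis e_basis.
case: n / n_dim e e_basis => e e_basis.
set n := \dim {:A}.
pose phi u : 'End(A) := passmx.hommx e e (vec_mx (u : 'rV[F]_(n * n))).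
have phi_lin : linear phi.
  by move=> k u v; rewrite /phi linearP passmx.hommx_linear.
pose phiM := GRing.isLinear.Build _ _ _ _ phi phi_lin.
pose phiL : {linear 'rV[F]_(n * n) -> 'End(A)} := HB.pack phi phiM.
have phi_sum r (k : 'I_r -> F) u :
    \sum_i k i *: phi (u i) = phi (\sum_i k i *: u i).
  rewrite [RHS](linear_sum phiL); apply: eq_bigr => i _.
  exact/esym/(linearZ_LR phiL).
have phi_eq0 u : phi u = 0 -> u = 0.
  move/eqP; rewrite passmx.hommx_eq0 // => /eqP u0.
  by rewrite -[u]vec_mxK u0 linear0.
have phi_inj u v : phi u = phi v -> u = v.
  move/eqP; rewrite -subr_eq0 -(linearB phiL) => /eqP /phi_eq0 /eqP.
  by rewrite subr_eq0 => /eqP.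
have phi_mx u : mx_in_basis e (phi u) = (vec_mx u)^T.
  apply/matrixP => i j; rewrite !mxE passmx.hommxE //.
  by rewrite passmx.coord_vecof // passmx.rVofE // -rowE !mxE.
have phi_surj f : exists u, f = phi u.
  exists (mxvec (passmx.mxof e e f)).
  by rewrite /phi mxvecK passmx.mxofK.
pose B := row_base (skew_def (Phant F) n).
pose X := [tuple phi (row i B) | i < \rank (skew_def (Phant F) n)].
have sumX (k : 'I__ -> F) :
    \sum_i k i *: X`_i = phi ((\row_i k i) *m B).
  rewrite mulmx_sum_row -phi_sum; apply: eq_bigr => i _.
  by rewrite mxE -tnth_nth tnth_mktuple.
exists <<X>>%VS; split; last first.
  have /eqP -> : free X.
    apply/freeP => k; rewrite sumX => /phi_eq0 /eqP.
    rewrite mul_mx_rowfree_eq0 ?row_base_free // => /eqP k0 i.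
    by have := congr1 (fun M : 'rV_ _ => M 0 i) k0; rewrite !mxE.
  by rewrite size_tuple rank_skew bin2.
move=> f; have [u ->] := phi_surj f.
rewrite phi_mx antisymmetric_mx_tr; split=> [/coord_span|/skewP].
  rewrite sumX => /phi_inj ->; apply/skewP.
  by rewrite (submx_trans (submxMl _ _)) // eq_row_base.
rewrite -(eq_row_base (skew_def (Phant F) n)) => /submxP[v ->].
have -> : v = \row_i v 0 i by apply/rowP => i; rewrite mxE.
rewrite -sumX; apply: memv_suml => i _.
by rewrite memvZ // memv_span // mem_nth // size_tuple.
Qed.
End SkewMatrices.

(** * Local derivations *)

Theorem local_derivations_antisymmetric (F : numFieldType) (A : vectType F)
    (S : composition_algebra A) (dimA : \dim {:A} = 8%N) (a b c : A)
    (abc_orthonormal : is_orthonormal S [:: aone S; a; b; c])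
    (c_ab_orthogonal : aform S c (amul S a b) = 0) :
  (forall f : 'End(A),
     is_local_derivation S f <->
     antisymmetric_mx (mx_in_basis (std_basis S a b c) f)) /\
  (exists LocDer : {vspace 'End(A)},
     (forall f : 'End(A), f \in LocDer <-> is_local_derivation S f) /\
     \dim LocDer = 28%N).
Proof.
have one_neq0 : aone S != 0.
  apply/eqP => one0; have A0 : {:A}%VS = 0%VS.
    apply/eqP; rewrite -subv0; apply/subvP => x _.
    by rewrite -(@amul1x _ _ S x) one0 linear0l mem0v.
  by rewrite A0 dimv0 in dimA.
set e := std_basis S a b c.
have e_orth : is_orthonormal S e by apply: std_basis_orthonormal.
have e_basis : basis_of {:A} e.
  by rewrite basisEfree (orthonormal_free _ e_orth) // subvf size_tuple dimA.
have locP f : is_local_derivation S f <-> antisymmetric_mx (mx_in_basis e f).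
  apply: (iff_trans (local_derivationP one_neq0 e_orth e_basis isT f)).
  exact: (iff_sym (antisymmetric_mxP one_neq0 e_orth e_basis f)).
split=> //; have [V [inV dimV]] := antisymmetric_space e_basis.
exists V; split; last by rewrite dimV.
by move=> f; exact: (iff_trans (inV f) (iff_sym (locP f))).
Qed.

Theorem theorem8 (R : realType) (A : vectType R[i])
    (S : composition_algebra A) (dimA : \dim {:A} = 8%N) (a b c : A)
    (abc_orthonormal : is_orthonormal S [:: aone S; a; b; c])
    (c_ab_orthogonal : aform S c (amul S a b) = 0) :
  (forall f : 'End(A),
     is_local_derivation S f <->
     antisymmetric_mx (mx_in_basis (std_basis S a b c) f)) /\
  (exists LocDer : {vspace 'End(A)},
     (forall f : 'End(A), f \in LocDer <-> is_local_derivation S f) /\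
     \dim LocDer = 28%N).
Proof. exact: local_derivations_antisymmetric. Qed.
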